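(* Let $(M^n,g,\nabla,\phi,\eta,\xi)$ be a quadratic metric $\phi$-hypersurface of a locally metallic Riemannian manifold $(\tilde M^{n+1},\tilde g,\tilde\nabla,J)$ with $J^2=pJ+qI$, and let $A$ be its shape operator. Then the characteristic vector field $\xi$ is a Killing vector field on $(M^n,g)$ if and only if $\phi A+A\phi=2pA$.
   Context: A metallic structure on a manifold $\tilde M$ is a $(1,1)$-tensor field $J$ with $J^2=pJ+qI$, where $p,q$ are positive integers. $(\tilde M,\tilde g,J)$ is a metallic Riemannian manifold if $\tilde g$ is a Riemannian metric with $\tilde g(JX,Y)=\tilde g(X,JY)$ for all $X,Y$; it is locally metallic if in addition $\tilde\nabla J=0$ for the Levi-Civita connection $\tilde\nabla$ of $\tilde g$. A quadratic metric $\phi$-hypersurface is a hypersurface $M^n$ of $\tilde M^{n+1}$ with a globally defined unit normal vector field $\nu$, with induced metric $g$ and its Levi-Civita connection $\nabla$, together with a $(1,1)$-tensor field $\phi$, a unit tangent vector field $\xi$ and a $1$-form $\eta$ on $M^n$ such that, for all $X$ tangent to $M^n$, $$JX=\phi X+\eta(X)\nu,\qquad J\nu=q\xi+p\nu,\qquad J\xi=\nu,$$ with $\eta(\xi)=1$, $\eta\circ\phi=0$, and such that $(g,\phi,\eta,\xi)$ is an almost quadratic metric $\phi$-structure: $\phi\xi=0$, $\phi^2=p\phi+q(I-\eta\otimes\xi)$, $g(\phi X,Y)=g(X,\phi Y)$ and $g(\phi X,\phi Y)=p\,g(\phi X,Y)+q(g(X,Y)-\eta(X)\eta(Y))$. The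 shape operator $A$ is defined by $\tilde\nabla_X\nu=-AX$, so that $\tilde\nabla_XY=\nabla_XY+g(AX,Y)\nu$ for $X,Y$ tangent to $M^n$. *)

(* Defs.v *)
From mathcomp Require Import all_boot all_order all_algebra.
From mathcomp Require Import all_classical all_reals all_analysis.

Set Implicit Arguments.
Unset Strict Implicit.
Unset Printing Implicit Defensive.

Import Order.TTheory GRing.Theory Num.Theory.
Import numFieldNormedType.Exports.

Local Open Scope classical_set_scope.
Local Open Scope ring_scope.

(* Class C^k on [U]; only meaningful for [U] open. *)
Fixpoint Ck (R : realType) (n : nat) (V : normedModType R) (k : nat)
    (U : set 'rV[R]_n) (f : 'rV[R]_n -> V) : Prop :=
  match k with
  | 0%N => forall u, U u -> {for u, continuous f}
  | k'.+1 => (forall u, U u -> differentiable f u) /\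
             (forall v, Ck k' U ('D_v f))
  end.

Definition smooth_on (R : realType) (n : nat) (V : normedModType R)
    (U : set 'rV[R]_n) (f : 'rV[R]_n -> V) : Prop := forall k, Ck k U f.

(* A smooth manifold of dimension n, given by an atlas indexed by the points:
   [chart x] is a chart around [x] with domain [dom x] and inverse [param x].
   Any atlas can be put in this form by selecting a chart around each point.
   The tangent space at [x] is identified with R^n through [chart x], so that
   a tangent vector at [x] is an element of ['rV[R]_n], namely the row of its
   components in the chart [chart x]. *)
Record smooth_manifold (R : realType) (n : nat) := SmoothManifold {
  space :> topologicalType;
  dom : space -> set space;
  chart : space -> space -> 'rV[R]_n;
  param : space -> 'rV[R]_n -> space;
  space_hausdorff : hausdorff_space space;
  space_second_countable : @second_countable space;
  dom_open : forall x, open (dom x);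
  dom_center : forall x, dom x x;
  chart_image_open : forall x, open (chart x @` dom x);
  chartK : forall x y, dom x y -> param x (chart x y) = y;
  chart_continuous : forall x y, dom x y -> {for y, continuous (chart x)};
  param_continuous : forall x u, (chart x @` dom x) u ->
    {for u, continuous (param x)};
  transition_smooth : forall x y,
    smooth_on (chart x @` (dom x `&` dom y)) (chart y \o param x) }.

Definition smooth_fun (R : realType) (n : nat) (M : smooth_manifold R n)
    (V : normedModType R) (U : set M) (f : M -> V) : Prop :=
  forall c : M, smooth_on (chart c @` (dom c `&` U)) (f \o param c).

(* [dif f x v] is v(f), the derivative of [f] along the tangent vector [v]
   at [x]. *)
Definition dif (R : realType) (n : nat) (M : smooth_manifold R n)
    (V : normedModType R) (f : M -> V) (x : M) (v : 'rV[R]_n) : V :=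
  'd (f \o param x) (chart x x) v.

Definition smooth_map (R : realType) (n m : nat) (M : smooth_manifold R n)
    (N : smooth_manifold R m) (f : M -> N) : Prop :=
  continuous f /\
  forall d : N, smooth_fun (f @^-1` dom d) (chart d \o f).

Definition tangent_map (R : realType) (n m : nat) (M : smooth_manifold R n)
    (N : smooth_manifold R m) (f : M -> N) (x : M) : 'rV[R]_n -> 'rV[R]_m :=
  dif (chart (f x) \o f) x.

Definition immersion (R : realType) (n m : nat) (M : smooth_manifold R n)
    (N : smooth_manifold R m) (f : M -> N) : Prop :=
  smooth_map f /\ forall x, injective (tangent_map f x).

(* Smoothness on [U] of a vector field [V] along [f], i.e. V x is a tangent
   vector of N at f x.  For [w] tangent at [y], [dif (chart d) y w] is the row
   of the components of [w] in the chart [chart d]. *)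
Definition smooth_along (R : realType) (n m : nat) (M : smooth_manifold R n)
    (N : smooth_manifold R m) (f : M -> N) (U : set M)
    (V : M -> 'rV[R]_m) : Prop :=
  forall d : N, smooth_fun (U `&` f @^-1` dom d)
                           (fun x => dif (chart d) (f x) (V x)).

Definition smooth_field (R : realType) (n : nat) (M : smooth_manifold R n)
    (U : set M) (X : M -> 'rV[R]_n) : Prop :=
  smooth_along (@id M) U X.

Definition tensor11 (R : realType) (n : nat) (M : smooth_manifold R n)
    (T : M -> 'rV[R]_n -> 'rV[R]_n) : Prop :=
  (forall x, linear (T x)) /\
  (forall U X, open U -> smooth_field U X ->
     smooth_field U (fun x => T x (X x))).

Definition one_form (R : realType) (n : nat) (M : smooth_manifold R n)
    (w : M -> 'rV[R]_n -> R) : Prop :=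
  (forall x, scalar (w x)) /\
  (forall U X, open U -> smooth_field U X ->
     smooth_fun U (fun x => w x (X x))).

Record riemannian_metric (R : realType) (n : nat) (M : smooth_manifold R n)
    (g : M -> 'rV[R]_n -> 'rV[R]_n -> R) : Prop := RiemannianMetric {
  metric_linear : forall x u, scalar (g x u);
  metric_sym : forall x u v, g x u v = g x v u;
  metric_pos : forall x u, u != 0 -> 0 < g x u u;
  metric_smooth : forall U X Y, open U -> smooth_field U X ->
    smooth_field U Y -> smooth_fun U (fun x => g x (X x) (Y x)) }.

(* Components of [X, Y] at x in [chart x]: the k-th one is
   X (Y x^k) - Y (X x^k), where x^k are the coordinates of [chart x]. *)
Definition lie_bracket (R : realType) (n : nat) (M : smooth_manifold R n)
    (X Y : M -> 'rV[R]_n) (x : M) : 'rV[R]_n :=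
  dif (fun y => dif (chart x) y (Y y)) x (X x)
  - dif (fun y => dif (chart x) y (X y)) x (Y x).

(* A connection in the pull-back by [f] of the tangent bundle of N:
   [D V x v] is the covariant derivative at [x] of the vector field [V] along
   [f] in the direction [v].  Connections act on locally defined sections;
   the value of [D V x v] is irrelevant if [V] is not smooth around [x]. *)
Record connection_along (R : realType) (n m : nat) (M : smooth_manifold R n)
    (N : smooth_manifold R m) (f : M -> N)
    (D : (M -> 'rV[R]_m) -> M -> 'rV[R]_n -> 'rV[R]_m) : Prop :=
  ConnectionAlong {
  conn_local : forall U V W x v, open U -> smooth_along f U V ->
    smooth_along f U W -> (forall y, U y -> V y = W y) -> U x ->
    D V x v = D W x v;
  conn_linear : forall U V x, open U -> smooth_along f U V -> U x ->
    linear (D V x);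
  conn_add : forall U V W x v, open U -> smooth_along f U V ->
    smooth_along f U W -> U x ->
    D (fun y => V y + W y) x v = D V x v + D W x v;
  conn_leibniz : forall U (h : M -> R) V x v, open U -> smooth_fun U h ->
    smooth_along f U V -> U x ->
    D (fun y => h y *: V y) x v = dif h x v *: V x + h x *: D V x v;
  conn_smooth : forall U V X, open U -> smooth_along f U V ->
    smooth_field U X -> smooth_along f U (fun x => D V x (X x)) }.

Record levi_civita (R : realType) (n : nat) (M : smooth_manifold R n)
    (g : M -> 'rV[R]_n -> 'rV[R]_n -> R)
    (nabla : (M -> 'rV[R]_n) -> M -> 'rV[R]_n -> 'rV[R]_n) : Prop :=
  LeviCivita {
  lc_connection : connection_along (@id M) nabla;
  lc_metric : forall U Y Z x v, open U -> smooth_field U Y ->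
    smooth_field U Z -> U x ->
    dif (fun y => g y (Y y) (Z y)) x v =
      g x (nabla Y x v) (Z x) + g x (Y x) (nabla Z x v);
  lc_torsion_free : forall U X Y x, open U -> smooth_field U X ->
    smooth_field U Y -> U x ->
    nabla Y x (X x) - nabla X x (Y x) = lie_bracket X Y x }.

(* [D] is the pull-back by [f] of the connection [nabla] of N; it gives a
   meaning to the covariant derivative of a vector field that is only defined
   along [f]. *)
Definition pullback_connection (R : realType) (n m : nat)
    (M : smooth_manifold R n) (N : smooth_manifold R m) (f : M -> N)
    (nabla : (N -> 'rV[R]_m) -> N -> 'rV[R]_m -> 'rV[R]_m)
    (D : (M -> 'rV[R]_m) -> M -> 'rV[R]_n -> 'rV[R]_m) : Prop :=
  connection_along f D /\
  forall (W : set N) Z x v, open W -> smooth_field W Z -> W (f x) ->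
    D (Z \o f) x v = nabla Z (f x) (tangent_map f x v).

(* The Lie derivative of g along xi vanishes. *)
Definition killing (R : realType) (n : nat) (M : smooth_manifold R n)
    (g : M -> 'rV[R]_n -> 'rV[R]_n -> R) (xi : M -> 'rV[R]_n) : Prop :=
  forall U X Y x, open U -> smooth_field U X -> smooth_field U Y -> U x ->
    dif (fun y => g y (X y) (Y y)) x (xi x)
    - g x (lie_bracket xi X x) (Y x) - g x (X x) (lie_bracket xi Y x) = 0.

Record metallic_structure (R : realType) (n : nat) (M : smooth_manifold R n)
    (p q : nat) (J : M -> 'rV[R]_n -> 'rV[R]_n) : Prop := MetallicStructure {
  metallic_p : (0 < p)%N;
  metallic_q : (0 < q)%N;
  metallic_tensor : tensor11 J;
  metallic_eq : forall x v, J x (J x v) = p%:R *: J x v + q%:R *: v }.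

Record metallic_riemannian (R : realType) (n : nat) (M : smooth_manifold R n)
    (p q : nat) (g : M -> 'rV[R]_n -> 'rV[R]_n -> R)
    (J : M -> 'rV[R]_n -> 'rV[R]_n) : Prop := MetallicRiemannian {
  mr_structure : metallic_structure p q J;
  mr_metric : riemannian_metric g;
  mr_compat : forall x u v, g x (J x u) v = g x u (J x v) }.

(* The last condition is nabla J = 0, as
   (nabla_v J) Y = nabla_v (J Y) - J (nabla_v Y). *)
Record locally_metallic (R : realType) (n : nat) (M : smooth_manifold R n)
    (p q : nat) (g : M -> 'rV[R]_n -> 'rV[R]_n -> R)
    (nabla : (M -> 'rV[R]_n) -> M -> 'rV[R]_n -> 'rV[R]_n)
    (J : M -> 'rV[R]_n -> 'rV[R]_n) : Prop := LocallyMetallic {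
  lm_metallic : metallic_riemannian p q g J;
  lm_levi_civita : levi_civita g nabla;
  lm_parallel : forall U Y x v, open U -> smooth_field U Y -> U x ->
    nabla (fun y => J y (Y y)) x v - J x (nabla Y x v) = 0 }.

Record almost_quadratic_metric (R : realType) (n : nat)
    (M : smooth_manifold R n) (p q : nat)
    (g : M -> 'rV[R]_n -> 'rV[R]_n -> R) (phi : M -> 'rV[R]_n -> 'rV[R]_n)
    (eta : M -> 'rV[R]_n -> R) (xi : M -> 'rV[R]_n) : Prop :=
  AlmostQuadraticMetric {
  aq_phi_tensor : tensor11 phi;
  aq_eta_form : one_form eta;
  aq_xi_smooth : smooth_field [set: M] xi;
  aq_eta_xi : forall x, eta x (xi x) = 1;
  aq_eta_phi : forall x v, eta x (phi x v) = 0;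
  aq_phi_xi : forall x, phi x (xi x) = 0;
  aq_phi2 : forall x v,
    phi x (phi x v) = p%:R *: phi x v + q%:R *: (v - eta x v *: xi x);
  aq_phi_sym : forall x u v, g x (phi x u) v = g x u (phi x v);
  aq_phi_phi : forall x u v,
    g x (phi x u) (phi x v) =
      p%:R * g x (phi x u) v + q%:R * (g x u v - eta x u * eta x v) }.

Record quadratic_metric_hypersurface (R : realType) (n p q : nat)
    (M : smooth_manifold R n) (N : smooth_manifold R n.+1)
    (gN : N -> 'rV[R]_n.+1 -> 'rV[R]_n.+1 -> R)
    (J : N -> 'rV[R]_n.+1 -> 'rV[R]_n.+1) (i : M -> N)
    (nu : M -> 'rV[R]_n.+1) (g : M -> 'rV[R]_n -> 'rV[R]_n -> R)
    (phi : M -> 'rV[R]_n -> 'rV[R]_n) (eta : M -> 'rV[R]_n -> R)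
    (xi : M -> 'rV[R]_n) : Prop := QuadraticMetricHypersurface {
  qh_immersion : immersion i;
  qh_induced : forall x u v,
    g x u v = gN (i x) (tangent_map i x u) (tangent_map i x v);
  qh_nu_smooth : smooth_along i [set: M] nu;
  qh_nu_unit : forall x, gN (i x) (nu x) (nu x) = 1;
  qh_nu_normal : forall x v, gN (i x) (nu x) (tangent_map i x v) = 0;
  qh_structure : almost_quadratic_metric p q g phi eta xi;
  qh_xi_unit : forall x, g x (xi x) (xi x) = 1;
  qh_J_tangent : forall x v,
    J (i x) (tangent_map i x v) =
      tangent_map i x (phi x v) + eta x v *: nu x;
  qh_J_nu : forall x,
    J (i x) (nu x) = q%:R *: tangent_map i x (xi x) + p%:R *: nu x;
  qh_J_xi : forall x, J (i x) (tangent_map i x (xi x)) = nu x }.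

(* [D] is meant to be the covariant derivative of the ambient manifold along
   the hypersurface [i]. *)
Definition shape_operator (R : realType) (n : nat)
    (M : smooth_manifold R n) (N : smooth_manifold R n.+1) (i : M -> N)
    (D : (M -> 'rV[R]_n.+1) -> M -> 'rV[R]_n -> 'rV[R]_n.+1)
    (nu : M -> 'rV[R]_n.+1) (A : M -> 'rV[R]_n -> 'rV[R]_n) : Prop :=
  forall x v, D nu x v = - tangent_map i x (A x v).

(* Main.v *)
From HB Require Import structures.
Require Import Defs.
From mathcomp Require Import all_boot all_order all_algebra.
From mathcomp Require Import all_classical all_reals all_analysis.
From mathcomp Require Import ring lra.

Set Implicit Arguments.
Unset Strict Implicit.
Unset Printing Implicit Defensive.

Import Order.TTheory GRing.Theory Num.Theory.
Import numFieldNormedType.Exports.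

Local Open Scope classical_set_scope.
Local Open Scope ring_scope.

(** Let D be the ambient covariant derivative of fields along the immersion i,
    and di the tangent map of i.  Since J is parallel and
    q di(xi) = J nu - p nu, differentiating and using D_v nu = - di (A v) gives
      q D_v (di xi) = di (p A v - phi (A v)) - eta (A v) nu
    ([derivative_xi]).  On the other hand D preserves the ambient metric and
    satisfies D_X (di Y) - D_Y (di X) = di [X, Y], so that
      (L_xi g)(X, Y) = gN (D_X (di xi), di Y) + gN (di X, D_Y (di xi)).
    Here the normal parts disappear; as A and phi are self-adjoint this becomes
      q (L_xi g)(X, Y) = g ((2 p A - phi A - A phi) X, Y)
    ([killing_expression]).  The theorem follows because q is nonzero, g is
    definite and every tangent vector extends to a smooth local field.

    The self-adjointness of A ([shape_operator_sym]) comes from differentiating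
    gN (nu, di Y) = 0 and from the fact that di [X, Y] is tangent.

    The substance is to transfer three properties of the ambient Levi-Civita
    connection to D, which acts on fields that are defined only along i:
    [pullback_metric], [pullback_parallel] and [pullback_torsion_free].  Near a
    point such a field is a combination, with functions as coefficients, of
    pulled-back coordinate fields, on which D is known; this is the induction
    principle [section_ind].  It settles the first two, because both sides obey
    the same Leibniz rule.  For the third, D is first written in coordinates
    ([pullback_coordE]); what has to cancel is then symmetric, because the
    second derivatives of i commute ([smooth_at_schwarz]) and the Christoffel
    symbols are symmetric ([nabla_frame_sym]).

    Smoothness, which is defined by means of all charts and open sets, is
    handled through germs read in the chart centred at the point
    ([smooth_germ], [smooth_section]). *)

(** * Calculus in normed spaces *)

Section Differentiable.
Variables (R : realType) (V W : normedModType R).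
Implicit Types f g : V -> W.

Lemma near0_differentiable f (a : V) :
  (\near a, f a = 0) -> differentiable f a.
Proof.
move=> f0.
have fa : f a = 0 by exact: nbhs_singleton f0.
have H : f \o shift a = cst (f a) + (0 : V -> W) +o_ 0 id.
  apply/eqaddoP => _/posnumP[e]; rewrite fa.
  have f0' : \forall u \near 0, f (u + a) = 0.
    move: (f0); rewrite (near_shift 0 a); apply: filterS => u /=.
    by rewrite subr0.
  near=> u.
  rewrite -[X in X <= _]/(`|f (u + a) - (0 + 0)|) addr0 subr0.
  rewrite (near f0' u) //.
  by rewrite normr0 mulr_ge0.
apply/diff_locallyP.
have -> : 'd f a = (0 : V -> W) :> (V -> W).
  rewrite -(@diff_cst _ V W 0 a).
  by apply: diff_unique; rewrite ?diff_cst //; exact: cst_continuous.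
by split => //; exact: cst_continuous.
Unshelve. all: by end_near. Qed.

Lemma near_eq_differentiable f g (a : V) :
  {near a, f =1 g} -> differentiable f a -> differentiable g a.
Proof.
move=> fg df; have -> : g = f + (g - f) by rewrite addrC subrK.
apply: differentiableD => //; apply: near0_differentiable.
by apply: filterS fg => v fgv; rewrite -[LHS]/(g v - f v) fgv subrr.
Qed.

Lemma near_eq_diff f g (a : V) :
  differentiable f a -> {near a, f =1 g} -> 'd f a = 'd g a :> (V -> W).
Proof.
move=> df fg; apply/funext => v.
rewrite -!deriveE //; last exact: near_eq_differentiable df.
exact: near_eq_derive.
Qed.

End Differentiable.

Section Scale.
Variables (R : realType) (W : normedModType R).

(** The general product rule for bilinear maps then covers the product of a
    function and a vector-valued function. *)
Fact scale_is_bilinear :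
  bilinear_for (GRing.Scale.Law.clone _ _ *:%R _)
    (GRing.Scale.Law.clone _ _ *:%R _) (@GRing.scale R W).
Proof.
split=> [w|r] a x y /=; first by rewrite scalerDl scalerA.
by rewrite scalerDr !scalerA mulrC.
Qed.
HB.instance Definition _ := bilinear_isBilinear.Build R R W W _ _
  (@GRing.scale R W) scale_is_bilinear.

Lemma differentiable_scale (V : normedModType R) (h : V -> R) (f : V -> W) a :
  differentiable h a -> differentiable f a ->
  differentiable (fun v => h v *: f v) a.
Proof.
move=> dh df.
have sc : continuous (fun z : R * W => z.1 *: z.2) by exact: scale_continuous.
exact: (differentiable_comp (differentiable_pair dh df)
  (differentiable_bilin (f := @GRing.scale R W) (h a, f a) sc)).
Qed.

Lemma diff_scale (V : normedModType R) (h : V -> R) (f : V -> W) a v :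
  differentiable h a -> differentiable f a ->
  'd (fun v => h v *: f v) a v = 'd h a v *: f a + h a *: 'd f a v.
Proof.
move=> dh df.
have sc : continuous (fun z : R * W => z.1 *: z.2) by exact: scale_continuous.
have db := differentiable_bilin (f := @GRing.scale R W) (h a, f a) sc.
rewrite (diff_comp (differentiable_pair dh df) db) /= diff_pair //.
by rewrite (diff_bilin (f := @GRing.scale R W) (h a, f a) sc) /= addrC.
Qed.
End Scale.

(** * Functions of class C^k on open sets of R^n *)

Section Ck.
Variables (R : realType) (n : nat).

Section Basic.
Variable V : normedModType R.
Implicit Types (U : set 'rV[R]_n) (f g : 'rV[R]_n -> V).

(** Allows sets to be cut down, and smoothness to be glued from local pieces. *)
Lemma Ck_pointwise k U f :
  Ck k U f <-> forall u, U u -> Ck k [set u] f.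
Proof.
elim: k f => [|k IH] f /=.
  by split=> H u Uu; [move=> _ ->; exact: H|exact: (H u Uu u)].
split=> [[df Hf] u Uu|H].
  split=> [_ ->|v]; first exact: df.
  by have [H _] := IH ('D_v f); exact: H (Hf v) u Uu.
split=> [u Uu|v]; first exact: (H u Uu).1.
by apply/IH => u /H[_]; apply.
Qed.

Lemma Ck_subset k U U' f : U' `<=` U -> Ck k U f -> Ck k U' f.
Proof.
by move=> U'U /Ck_pointwise H; apply/Ck_pointwise => u /U'U; exact: H.
Qed.

(** On an open set, equal functions have equal directional derivatives, so the
    induction on k goes through. *)
Lemma Ck_eq k U f g : open U -> {in U, f =1 g} -> Ck k U f -> Ck k U g.
Proof.
move=> oU.
have near_fg (h h' : 'rV[R]_n -> V) u :
    {in U, h =1 h'} -> U u -> {near u, h =1 h'}.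
  move=> hh' Uu; apply: filterS (open_nbhs_nbhs (conj oU Uu)) => v Uv.
  by apply: hh'; rewrite inE.
elim: k f g => [|k IH] f g fg /=.
  move=> H u Uu; have nfg := near_fg _ _ _ fg Uu.
  rewrite /prop_for /continuous_at -(nbhs_singleton nfg).
  exact: cvg_trans (near_eq_cvg nfg) (H u Uu).
move=> [df Hf]; split=> [u Uu|v].
  exact: near_eq_differentiable (near_fg _ _ _ fg Uu) (df _ Uu).
apply: IH (Hf v) => u; rewrite inE => Uu.
exact: near_eq_derive (near_fg _ _ _ fg Uu).
Qed.

Lemma CkW k U f : Ck k.+1 U f -> Ck k U f.
Proof.
elim: k f => [|k IH] f [df Hf].
  by move=> u Uu; exact: differentiable_continuous (df u Uu).
by split=> // v; exact: IH (Hf v).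
Qed.

Lemma Ck_cst k U (c : V) : open U -> Ck k U (fun=> c).
Proof.
elim: k c => [|k IH] c oU /=; first by move=> u _; exact: cst_continuous.
split=> [u _|v]; first exact: differentiable_cst.
apply: (Ck_eq (f := fun=> 0)) (IH 0 oU) => // u _.
by rewrite [RHS]derive_cst.
Qed.

Lemma CkD k U f g : open U -> Ck k U f -> Ck k U g ->
  Ck k U (fun u => f u + g u).
Proof.
move=> oU; elim: k f g => [|k IH] f g /=.
  by move=> cf cg u Uu; exact: continuousD (cf u Uu) (cg u Uu).
move=> [df Hf] [dg Hg]; split=> [u Uu|v].
  exact: differentiableD (df u Uu) (dg u Uu).
apply: Ck_eq (IH _ _ (Hf v) (Hg v)) => // u; rewrite inE => Uu.
by rewrite [RHS]deriveD //; apply: diff_derivable; [exact: df|exact: dg].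
Qed.

End Basic.

Section Scale.
Variable V : normedModType R.
Implicit Types (U : set 'rV[R]_n) (f g : 'rV[R]_n -> V).

Lemma CkZ k U (h : 'rV[R]_n -> R) f : open U -> Ck k U h -> Ck k U f ->
  Ck k U (fun u => h u *: f u).
Proof.
move=> oU; elim: k h f => [|k IH] h f.
  move=> ch cf u Uu; exact: cvgZ (ch u Uu) (cf u Uu).
move=> Ckh Ckf; have [dh Hh] := Ckh; have [df Hf] := Ckf.
split=> [u Uu|v]; first exact: differentiable_scale (dh u Uu) (df u Uu).
have := CkD oU (IH _ _ (Hh v) (CkW Ckf)) (IH _ _ (CkW Ckh) (Hf v)).
apply: Ck_eq => // u; rewrite inE => Uu.
rewrite !deriveE ?diff_scale//; try exact: dh; try exact: df.
by apply: differentiable_scale; [exact: dh|exact: df].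
Qed.

Lemma Ck_sum k U (I : Type) (s : seq I) (F : I -> 'rV[R]_n -> V) : open U ->
  (forall i, Ck k U (F i)) -> Ck k U (fun u => \sum_(i <- s) F i u).
Proof.
move=> oU HF; elim: s => [|i s IH].
  by apply: Ck_eq (Ck_cst _ 0 oU) => // u _; rewrite big_nil.
by apply: Ck_eq (CkD oU (HF i) IH) => // u _; rewrite big_cons.
Qed.
End Scale.

Section Coordinates.
Variable m : nat.
Implicit Types (U : set 'rV[R]_n) (f : 'rV[R]_n -> 'rV[R]_m).

Lemma Ck_coord k U f (j : 'I_m) : open U -> Ck k U f ->
  Ck k U (fun u => f u 0 j).
Proof.
move=> oU; elim: k f => [|k IH] f /=.
  move=> cf u Uu.
  exact: (continuous_comp (cf u Uu) (@coord_continuous _ _ _ 0 j (f u))).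
move=> [df Hf]; split=> [u Uu|v].
  exact: (differentiable_comp (df u Uu)
    (@differentiable_coord _ _ _ (f u) 0 j)).
apply: Ck_eq (IH _ (Hf v)) => // u; rewrite inE => Uu.
by rewrite derive_mx ?mxE//; apply: diff_derivable; exact: df.
Qed.

Lemma diff_row (W : normedModType R) (F : 'rV[R]_m -> W) (u v : 'rV[R]_m) :
  'd F u v = \sum_j v 0 j *: 'd F u (delta_mx 0 j).
Proof.
rewrite {1}[v]row_sum_delta linear_sum; apply: eq_bigr => j _.
by rewrite linearZ.
Qed.

(** By the chain rule a directional derivative of F o f is a sum of products of
    components of the derivative of f with partial derivatives of F composed
    with f; all of these are of class C^k when f and F are of class C^(k+1). *)
Lemma Ck_comp (W : normedModType R) k U (U' : set 'rV[R]_m) f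
    (F : 'rV[R]_m -> W) :
  open U -> open U' -> (forall u, U u -> U' (f u)) ->
  Ck k U f -> Ck k U' F -> Ck k U (F \o f).
Proof.
move=> oU oU' fU; elim: k f F fU => [|k IH] f F fU.
  by move=> cf cF u Uu; exact: (continuous_comp (cf u Uu) (cF _ (fU _ Uu))).
move=> Ckf CkF; have [df Hf] := Ckf; have [dF HF] := CkF.
have dFf u : U u -> differentiable (F \o f) u.
  by move=> Uu; exact: (differentiable_comp (df u Uu) (dF _ (fU _ Uu))).
split=> [//|v].
have := @Ck_sum W k U _ (index_enum 'I_m) (fun j u => ('D_v f) u 0 j *:
   (('D_(delta_mx 0 j) F) \o f) u) oU.
have Hj j : Ck k U (fun u => ('D_v f) u 0 j *: (('D_(delta_mx 0 j) F) \o f) u).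
  by apply: CkZ => //; [exact: Ck_coord (Hf v)|exact: IH (CkW Ckf) (HF _)].
move=> /(_ Hj); apply: Ck_eq => // u; rewrite inE => Uu /=.
rewrite [RHS](deriveE _ (dFf _ Uu)).
rewrite (diff_comp (df u Uu) (dF _ (fU _ Uu))) /= diff_row.
apply: eq_bigr => j _.
by rewrite !deriveE //; do ?[exact: dF (fU _ Uu)|exact: df].
Qed.

End Coordinates.
End Ck.

(** * Symmetry of second derivatives *)

Section Schwarz.
Variables (R : realType) (V : normedModType R).
Implicit Types f : V -> R.

Lemma is_derive_line f (a v : V) (s : R) : differentiable f (a + s *: v) ->
  is_derive s 1 (fun t : R => f (a + t *: v)) ('D_v f (a + s *: v)).
Proof.
move=> df.
have dl : is_diff s (fun t : R => a + t *: v) (fun t : R => t *: v).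
  by apply: is_diff_eq; apply/funext => t /=; rewrite add0r.
have dl' : differentiable (fun t : R => a + t *: v) s by exact: ex_diff.
have dfl := differentiable_comp dl' df.
apply: DeriveDef; first exact: diff_derivable dfl.
by rewrite deriveE // (diff_comp dl' df) /= diff_val scale1r deriveE.
Qed.

(** The mean value theorem in the direction v, for f (. + h w) - f, and then in
    the direction w, for the derivative of f along v.  The second difference on
    the left is symmetric in v and w, which gives the symmetry below. *)
Lemma mixed_difference f (u v w : V) (h : R) : 0 < h ->
  (forall s t, 0 <= s <= h -> 0 <= t <= h ->
     differentiable f (u + s *: v + t *: w)) ->
  (forall s t, 0 <= s <= h -> 0 <= t <= h ->
     differentiable ('D_v f) (u + s *: v + t *: w)) ->
  exists s t, [/\ 0 <= s <= h, 0 <= t <= h &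
    f (u + h *: v + h *: w) - f (u + h *: v) - (f (u + h *: w) - f u) =
    'D_w ('D_v f) (u + s *: v + t *: w) * h * h].
Proof.
move=> h0 df ddf; have hh : 0 <= h <= h by rewrite lexx ltW.
have h00 : 0 <= (0 : R) <= h by rewrite lexx ltW.
pose phi s := f (u + h *: w + s *: v) - f (u + s *: v).
pose dphi s := 'D_v f (u + h *: w + s *: v) - 'D_v f (u + s *: v).
have dphiP s : 0 <= s <= h -> is_derive s 1 phi (dphi s).
  move=> sh; apply: is_deriveB; apply: is_derive_line.
    by rewrite addrAC; exact: df.
  by have := df s 0 sh h00; rewrite scale0r addr0.
have [s|s|s sI phiE] := @MVT _ phi dphi 0 h h0.
- by rewrite in_itv /= => /andP[s0 sh]; apply: dphiP; rewrite !ltW.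
- apply: derivable_within_continuous => {}s; rewrite in_itv /= => sh.
  by have := dphiP s sh => ?; exact: ex_derive.
have sh : 0 <= s <= h.
  by move: sI; rewrite in_itv /= => /andP[? ?]; rewrite !ltW.
pose psi t := 'D_v f (u + s *: v + t *: w).
have dpsiP t : 0 <= t <= h ->
    is_derive t 1 psi ('D_w ('D_v f) (u + s *: v + t *: w)).
  by move=> th; apply: is_derive_line; exact: ddf.
have [t|t|t tI psiE] :=
  @MVT _ psi (fun t => 'D_w ('D_v f) (u + s *: v + t *: w)) 0 h h0.
- by rewrite in_itv /= => /andP[t0 th]; apply: dpsiP; rewrite !ltW.
- apply: derivable_within_continuous => {}t; rewrite in_itv /= => th.
  by have := dpsiP t th => ?; exact: ex_derive.
exists s, t; split => //.
  by move: tI; rewrite in_itv /= => /andP[? ?]; rewrite !ltW.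
move: phiE psiE; rewrite /phi /psi /dphi !scale0r !addr0 !subr0 => phiE <-.
by rewrite -[u + s *: v + _]addrAC -phiE -[u + h *: v + _]addrAC; ring.
Qed.

(** The second difference of f over the parallelogram with sides h v and h w is
    h^2 times either mixed derivative at some point of the parallelogram; these
    points tend to u with h, and both derivatives are continuous. *)
Lemma schwarz f (u v w : V) :
  (\forall x \near u, differentiable f x) ->
  (\forall x \near u, differentiable ('D_v f) x) ->
  (\forall x \near u, differentiable ('D_w f) x) ->
  {for u, continuous ('D_w ('D_v f))} -> {for u, continuous ('D_v ('D_w f))} ->
  'D_w ('D_v f) u = 'D_v ('D_w f) u.
Proof.
move=> df dvf dwf cwv cvw; apply/eqP; rewrite -subr_eq0 -normr_le0.
apply/ler_addgt0Pl => e e0; rewrite addr0.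
have e2 : 0 < e / 2 by rewrite divr_gt0.
move/cvgrPdist_lt : cwv => /(_ _ e2) cwv.
move/cvgrPdist_lt : cvw => /(_ _ e2) cvw.
have /nbhs_ballP[r /= r0 rP] : \forall x \near u, [/\ differentiable f x,
    differentiable ('D_v f) x, differentiable ('D_w f) x,
    `|'D_w ('D_v f) u - 'D_w ('D_v f) x| < e / 2 &
    `|'D_v ('D_w f) u - 'D_v ('D_w f) x| < e / 2].
  apply: filterS (filterI (filterI df (filterI dvf dwf)) (filterI cwv cvw)).
  move=> x [[a [b c]] [d e']]; exact: And5 a b c d e'.
(* The parallelogram then lies in the ball of radius r; adding 1 keeps m
   positive when v = w = 0. *)
pose m := `|v| + `|w| + 1; pose h := r / m / 2.
have m0 : 0 < m by rewrite ltr_wpDl// addr_ge0.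
have h0 : 0 < h by rewrite !divr_gt0.
have near_u s t : 0 <= s <= h -> 0 <= t <= h -> ball u r (u + s *: v + t *: w).
  move=> /andP[s0 sh] /andP[t0 th].
  rewrite -ball_normE /ball_ /= -addrA opprD addrA subrr add0r normrN.
  rewrite (le_lt_trans (ler_normD _ _))// !normrZ !ger0_norm//.
  have hr : h * m < r.
    by rewrite /h mulrAC divfK ?gt_eqF// ltr_pdivrMr// ltr_pMr// ltr1n.
  have Hv := ler_wpM2r (normr_ge0 v) sh; have Hw := ler_wpM2r (normr_ge0 w) th.
  by move: hr; rewrite /m !mulrDr mulr1; lra.
have [s [t [sh th E1]]] : exists s t, [/\ 0 <= s <= h, 0 <= t <= h &
    f (u + h *: v + h *: w) - f (u + h *: v) - (f (u + h *: w) - f u) =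
    'D_w ('D_v f) (u + s *: v + t *: w) * h * h].
  apply: mixed_difference => [|s t sh th|s t sh th]; first exact: h0.
    by have [] := rP _ (near_u s t sh th).
  by have [] := rP _ (near_u s t sh th).
have [t' [s' [th' sh' E2]]] : exists t' s', [/\ 0 <= t' <= h, 0 <= s' <= h &
    f (u + h *: w + h *: v) - f (u + h *: w) - (f (u + h *: v) - f u) =
    'D_v ('D_w f) (u + t' *: w + s' *: v) * h * h].
  apply: mixed_difference => [|t' s' th' sh'|t' s' th' sh']; first exact: h0.
    by rewrite addrAC; have [] := rP _ (near_u s' t' sh' th').
  by rewrite addrAC; have [] := rP _ (near_u s' t' sh' th').
have [_ _ _ + _] := rP _ (near_u s t sh th).
have [_ _ _ _] := rP _ (near_u s' t' sh' th').
have -> : 'D_w ('D_v f) (u + s *: v + t *: w) =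
    'D_v ('D_w f) (u + s' *: v + t' *: w).
  have hn0 := lt0r_neq0 h0.
  rewrite (addrAC u (s' *: v)); apply/(mulIf hn0)/(mulIf hn0).
  apply: etrans (esym E1) _; apply: etrans _ E2.
  by rewrite (addrAC u (h *: w)); ring.
move=> bc ac; rewrite distrC in bc.
rewrite (splitr e); apply: le_trans (lerD (ltW ac) (ltW bc)).
exact: ler_distD.
Qed.
End Schwarz.

(** * Germs of smooth functions on R^n *)

Section SmoothAt.
Variables (R : realType) (n : nat).

(** Germs make it possible to change charts without tracking the domains. *)
Definition smooth_at (V : normedModType R) (f : 'rV[R]_n -> V)
    (u : 'rV[R]_n) : Prop :=
  exists U, [/\ open U, U u & smooth_on U f].

Section Basic.
Variable V : normedModType R.
Implicit Types (U : set 'rV[R]_n) (f g : 'rV[R]_n -> V) (u v : 'rV[R]_n).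

Lemma smooth_onP U f : open U ->
  smooth_on U f <-> forall u, U u -> smooth_at f u.
Proof.
move=> oU; split=> [sf u Uu|sf k]; first by exists U.
apply/Ck_pointwise => u /sf[U' [oU' U'u sf']].
by move: u U'u; apply/Ck_pointwise; exact: sf'.
Qed.

Lemma smooth_at_near f u : smooth_at f u -> \forall v \near u, smooth_at f v.
Proof.
move=> [U [oU Uu sf]]; apply: filterS (open_nbhs_nbhs (conj oU Uu)) => v Uv.
by exists U.
Qed.

Lemma smooth_at_eq f g u :
  {near u, f =1 g} -> smooth_at f u -> smooth_at g u.
Proof.
rewrite /prop_near1 nbhsE => -[U' [oU' U'u] U'fg] [U [oU Uu sf]].
exists (U `&` U'); split => [||k]; [exact: openI|by []|].
apply: (Ck_eq (f := f)); first exact: openI.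
  by move=> v; rewrite inE => -[_ /U'fg].
by apply: Ck_subset (sf k) => v [].
Qed.

Lemma smooth_at_differentiable f u : smooth_at f u -> differentiable f u.
Proof. by move=> [U [oU Uu sf]]; have [H _] := sf 1%N; exact: H. Qed.

Lemma smooth_at_continuous f u : smooth_at f u -> {for u, continuous f}.
Proof. by move=> /smooth_at_differentiable /differentiable_continuous. Qed.

Lemma smooth_at_derive f u v : smooth_at f u -> smooth_at ('D_v f) u.
Proof.
move=> [U [oU Uu sf]]; exists U; split => // k.
by have [_ H] := sf k.+1; exact: H.
Qed.

Lemma smooth_at_cst (c : V) u : smooth_at (fun=> c) u.
Proof.
by exists setT; split => [||k] //; [exact: openT|exact/Ck_cst/openT].
Qed.

Lemma smooth_atD f g u : smooth_at f u -> smooth_at g u ->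
  smooth_at (fun v => f v + g v) u.
Proof.
move=> [U [oU Uu sf]] [U' [oU' Uu' sg]]; have oI := openI oU oU'.
exists (U `&` U'); split => // k; apply: (CkD oI).
  by apply: Ck_subset (sf k) => v [].
by apply: Ck_subset (sg k) => v [].
Qed.

Lemma smooth_atZ (h : 'rV[R]_n -> R) f u : smooth_at h u -> smooth_at f u ->
  smooth_at (fun v => h v *: f v) u.
Proof.
move=> [U [oU Uu sf]] [U' [oU' Uu' sg]]; have oI := openI oU oU'.
exists (U `&` U'); split => // k; apply: (CkZ oI).
  by apply: Ck_subset (sf k) => v [].
by apply: Ck_subset (sg k) => v [].
Qed.

Lemma smooth_at_sum (I : Type) (s : seq I) (F : I -> 'rV[R]_n -> V) u :
  (forall i, smooth_at (F i) u) -> smooth_at (fun v => \sum_(i <- s) F i v) u.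
Proof.
move=> HF; elim: s => [|i s IH].
  under eq_fun do rewrite big_nil; exact: smooth_at_cst.
under eq_fun do rewrite big_cons; exact: smooth_atD.
Qed.
End Basic.

Lemma smooth_at_coord m (f : 'rV[R]_n -> 'rV[R]_m) u j : smooth_at f u ->
  smooth_at (fun v => f v 0 j) u.
Proof.
by move=> [U [oU Uu sf]]; exists U; split => // k; exact: Ck_coord (sf k).
Qed.
End SmoothAt.

Section SmoothComp.
Variables (R : realType) (n m : nat) (V : normedModType R).

Lemma smooth_at_comp (f : 'rV[R]_n -> 'rV[R]_m) (F : 'rV[R]_m -> V) u :
  smooth_at f u -> smooth_at F (f u) -> smooth_at (F \o f) u.
Proof.
move=> sf0 [U' [oU' Uu' sF]]; have [U [oU Uu sf]] := sf0.
have : nbhs u (U `&` f @^-1` U').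
  apply: filterI; first exact: open_nbhs_nbhs.
  by apply: (smooth_at_continuous sf0); exact: open_nbhs_nbhs.
rewrite nbhsE => -[W [oW Wu] WU].
exists W; split => // k; apply: (Ck_comp oW oU' _ _ (sF k)).
  by move=> v /WU[].
by apply: Ck_subset (sf k) => v /WU[].
Qed.

(** In the canonical basis the differential is a sum of products of the
    components of X with partial derivatives of F. *)
Lemma smooth_at_diff (f : 'rV[R]_n -> 'rV[R]_m) (F : 'rV[R]_m -> V)
    (X : 'rV[R]_n -> 'rV[R]_m) u :
  smooth_at f u -> smooth_at F (f u) -> smooth_at X u ->
  smooth_at (fun v => 'd F (f v) (X v)) u.
Proof.
move=> sf sF sX.
have Hj j : smooth_at
    (fun v => X v 0 j *: (('D_(delta_mx 0 j) F) \o f) v) u.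
  apply: smooth_atZ; first exact: smooth_at_coord.
  apply: smooth_at_comp; first exact: sf.
  exact: smooth_at_derive.
have := smooth_at_sum (index_enum 'I_m) Hj; apply: smooth_at_eq.
have dF : \forall v \near u, differentiable F (f v).
  have sFf : \forall v \near u, smooth_at F (f v).
    exact: smooth_at_continuous sf _ (smooth_at_near sF).
  by apply: filterS sFf => v; exact: smooth_at_differentiable.
apply: filterS dF => v dF; rewrite diff_row; apply: eq_bigr => j _ /=.
by rewrite deriveE.
Qed.

Lemma diff_scale_sum (I : Type) (s : seq I) (h : I -> 'rV[R]_n -> R)
    (G : I -> 'rV[R]_n -> V) u v :
  (forall i, smooth_at (h i) u) -> (forall i, smooth_at (G i) u) ->
  'd (fun w => \sum_(i <- s) h i w *: G i w) u v =
    \sum_(i <- s) ('d (h i) u v *: G i u + h i u *: 'd (G i) u v).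
Proof.
move=> sh sG; have shG i := smooth_atZ (sh i) (sG i).
elim: s => [|i s IH].
  rewrite big_nil; under eq_fun do rewrite big_nil.
  by rewrite [X in diff _ X](_ : _ = cst 0) // diff_cst.
rewrite big_cons -IH; under eq_fun do rewrite big_cons.
have dS := smooth_at_differentiable (smooth_at_sum s shG).
apply: etrans (congr1 (fun L : _ -> _ => L v)
  (diffD (smooth_at_differentiable (shG i)) dS)) _.
congr (_ + _); apply: diff_scale; exact: smooth_at_differentiable.
Qed.
End SmoothComp.

Lemma smooth_at_schwarz (R : realType) (n m : nat) (F : 'rV[R]_n -> 'rV[R]_m)
    u v w : smooth_at F u -> 'D_w ('D_v F) u = 'D_v ('D_w F) u.
Proof.
move=> sF.
have coordE (f : 'rV[R]_n -> 'rV[R]_m) j x y : smooth_at f x ->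
    ('D_y f x : 'rV[R]_m) 0 j = 'D_y (fun z => f z 0 j : R) x.
  move=> /smooth_at_differentiable df.
  by rewrite derive_mx ?mxE//; exact: diff_derivable.
apply/rowP => j.
have mixedE x y : ('D_y ('D_x F) u : 'rV[R]_m) 0 j =
    'D_y ('D_x (fun z => F z 0 j : R)) u.
  apply: etrans (coordE _ j u y (smooth_at_derive x sF)) _.
  apply: near_eq_derive; apply: filterS (smooth_at_near sF) => z.
  exact: coordE.
apply: etrans (mixedE v w) _; apply: etrans _ (esym (mixedE w v)).
have sFj := smooth_at_coord j sF.
have ds (f : 'rV[R]_n -> R) : smooth_at f u ->
    \forall x \near u, differentiable f x.
  move=> sf; apply: filterS (smooth_at_near sf) => x.
  exact: smooth_at_differentiable.
apply: schwarz.
- exact: ds.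
- exact/ds/smooth_at_derive.
- exact/ds/smooth_at_derive.
- exact/smooth_at_continuous/smooth_at_derive/smooth_at_derive.
- exact/smooth_at_continuous/smooth_at_derive/smooth_at_derive.
Qed.

(** The product rule for dF_w (Z w).  The second-order term is put in a form in
    which exchanging Z u and v is exactly [smooth_at_schwarz]. *)
Lemma diff_second (R : realType) (n m : nat) (F : 'rV[R]_n -> 'rV[R]_m)
    (Z : 'rV[R]_n -> 'rV[R]_n) u v : smooth_at F u -> smooth_at Z u ->
  'd (fun w => 'd F w (Z w)) u v =
    'd F u ('d Z u v) + 'D_(Z u) ('D_v F) u.
Proof.
move=> sF sZ; have dZ := smooth_at_differentiable sZ.
have sE j : smooth_at ('D_(delta_mx 0 j) F) u by exact: smooth_at_derive.
have sZj j := smooth_at_coord j sZ.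
have sS := smooth_at_sum (index_enum 'I_n)
  (fun j => smooth_atZ (sZj j) (sE j)).
have eF : {near u, (fun w => \sum_j Z w 0 j *: 'D_(delta_mx 0 j) F w) =1
    (fun w => 'd F w (Z w))}.
  apply: filterS (smooth_at_near sF) => w /smooth_at_differentiable dF.
  by rewrite diff_row; apply: eq_bigr => j _; rewrite deriveE.
apply: etrans (congr1 (fun L : _ -> _ => L v)
  (esym (near_eq_diff (smooth_at_differentiable sS) eF))) _.
apply: etrans (diff_scale_sum _ _ sZj sE) _.
rewrite big_split /=; congr (_ + _).
  rewrite [RHS]diff_row; apply: eq_bigr => j _.
  rewrite (deriveE _ (smooth_at_differentiable sF)); congr (_ *: _).
  rewrite -(deriveE _ (smooth_at_differentiable (sZj j))) -(deriveE _ dZ).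
  by rewrite derive_mx ?mxE//; exact: diff_derivable.
rewrite (deriveE _ (smooth_at_differentiable (smooth_at_derive v sF))).
rewrite [RHS]diff_row; apply: eq_bigr => j _; congr (_ *: _).
apply: etrans (esym (deriveE _ (smooth_at_differentiable (sE j)))) _.
apply: etrans (smooth_at_schwarz _ _ sF) _.
exact/deriveE/smooth_at_differentiable/smooth_at_derive.
Qed.

(** * Germs of smooth functions on a manifold *)

Section Charts.
Variables (R : realType) (n : nat) (M : smooth_manifold R n).
Implicit Types (c d x y : M).

Lemma nbhs_dom c x : dom c x -> nbhs x (dom c).
Proof. by move=> cx; apply: open_nbhs_nbhs; split => //; exact: dom_open. Qed.

Lemma nbhs_chart_image c x : dom c x -> nbhs (chart c x) (chart c @` dom c).
Proof.
move=> cx; apply: open_nbhs_nbhs; split; first exact: chart_image_open.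
by exists x.
Qed.

Lemma near_paramK c x : dom c x ->
  \forall u \near chart c x, dom c (param c u) /\ chart c (param c u) = u.
Proof.
move=> cx; apply: filterS (nbhs_chart_image cx) => _ [y cy <-].
by rewrite chartK.
Qed.

Lemma near_param c x (P : set M) : dom c x -> nbhs x P ->
  \forall u \near chart c x, P (param c u).
Proof.
move=> cx Px; apply: (param_continuous (u := chart c x)); first by exists x.
by rewrite chartK.
Qed.

Lemma near_chart c x (P : set 'rV[R]_n) : dom c x -> nbhs (chart c x) P ->
  \forall y \near x, P (chart c y).
Proof. by move=> cx; exact: (chart_continuous cx). Qed.

Lemma chart_open_image c (U : set M) :
  open U -> open (chart c @` (dom c `&` U)).
Proof.
move=> oU; rewrite openE => _ [y [cy Uy] <-].
have Uu := near_param cy (open_nbhs_nbhs (conj oU Uy)).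
apply: filterS (filterI (near_paramK cy) Uu) => u [[cu uK] {}Uu].
by exists (param c u).
Qed.

Lemma transition_smooth_at c d x : dom c x -> dom d x ->
  smooth_at (chart d \o param c) (chart c x).
Proof.
move=> cx dx.
apply: (smooth_onP _ _).1 (@transition_smooth _ _ M c d) _ _; last by exists x.
by apply: chart_open_image; exact: dom_open.
Qed.

End Charts.

Section SmoothGerm.
Variables (R : realType) (n : nat) (M : smooth_manifold R n).
Implicit Types (c d x y : M).

(** Reading f in the chart centred at x is enough: by [smooth_germ_chart] any
    other chart around x gives the same notion. *)
Definition smooth_germ (V : normedModType R) (f : M -> V) (x : M) : Prop :=
  smooth_at (f \o param x) (chart x x).

Section Basic.
Variable V : normedModType R.
Implicit Types (f g : M -> V).

Lemma smooth_germ_chart f c d x : dom c x -> dom d x ->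
  smooth_at (f \o param c) (chart c x) -> smooth_at (f \o param d) (chart d x).
Proof.
move=> cx dx sf.
have sfc : smooth_at ((f \o param c) \o (chart c \o param d)) (chart d x).
  by apply: smooth_at_comp; [exact: transition_smooth_at|rewrite /= chartK].
apply: smooth_at_eq sfc.
by apply: filterS (near_param dx (nbhs_dom cx)) => u cu /=; rewrite chartK.
Qed.

Lemma smooth_funP (U : set M) f : open U ->
  smooth_fun U f <-> forall x, U x -> smooth_germ f x.
Proof.
move=> oU; split=> [sf x Ux|sf c].
  have := sf x; rewrite smooth_onP; last exact: chart_open_image.
  by apply; exists x => //; split => //; exact: dom_center.
apply/smooth_onP; first exact: chart_open_image.
move=> _ [x [cx Ux] <-]; apply: smooth_germ_chart (sf x Ux) => //.
exact: dom_center.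
Qed.

Lemma smooth_germ_near f x :
  smooth_germ f x -> \forall y \near x, smooth_germ f y.
Proof.
move=> sf; have sf' := near_chart (dom_center x) (smooth_at_near sf).
apply: filterS (filterI (nbhs_dom (dom_center x)) sf') => y [xy].
by apply: smooth_germ_chart => //; exact: dom_center.
Qed.

Lemma smooth_germ_eq f g x :
  {near x, f =1 g} -> smooth_germ f x -> smooth_germ g x.
Proof.
move=> fg; apply: smooth_at_eq.
exact: (near_param (dom_center x) fg).
Qed.

Lemma smooth_germ_cst (a : V) x : smooth_germ (fun=> a) x.
Proof. exact: smooth_at_cst. Qed.

Lemma smooth_germD f g x : smooth_germ f x -> smooth_germ g x ->
  smooth_germ (fun y => f y + g y) x.
Proof. exact: smooth_atD. Qed.

Lemma smooth_germZ (h : M -> R) f x : smooth_germ h x -> smooth_germ f x ->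
  smooth_germ (fun y => h y *: f y) x.
Proof. exact: smooth_atZ. Qed.

Lemma smooth_germ_chartP c x : dom c x -> smooth_germ (chart c) x.
Proof. by move=> cx; apply: transition_smooth_at => //; exact: dom_center. Qed.

Lemma smooth_germ_postcomp m (f : M -> 'rV[R]_m) (F : 'rV[R]_m -> V) x :
  smooth_germ f x -> smooth_at F (f x) -> smooth_germ (F \o f) x.
Proof.
move=> sf sF; apply: (smooth_at_comp sf).
by rewrite /= chartK //; exact: dom_center.
Qed.

Lemma smooth_germ_diff m (f : M -> 'rV[R]_m) (F : 'rV[R]_m -> V)
    (X : M -> 'rV[R]_m) x :
  smooth_germ f x -> smooth_at F (f x) -> smooth_germ X x ->
  smooth_germ (fun y => 'd F (f y) (X y)) x.
Proof.
move=> sf sF sX; apply: (smooth_at_diff sf _ sX).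
by rewrite /= chartK //; exact: dom_center.
Qed.

Lemma dif_eq f g x v : smooth_germ f x -> {near x, f =1 g} ->
  dif f x v = dif g x v.
Proof.
move=> sf fg; rewrite /dif.
have fg' := near_param (dom_center x) fg.
by rewrite (near_eq_diff (g := g \o param x) (smooth_at_differentiable sf) fg').
Qed.

Lemma difD f g x v : smooth_germ f x -> smooth_germ g x ->
  dif (fun y => f y + g y) x v = dif f x v + dif g x v.
Proof.
move=> /smooth_at_differentiable df /smooth_at_differentiable dg.
rewrite /dif [X in diff _ X](_ : _ = (f \o param x) + (g \o param x)) //.
by rewrite diffD.
Qed.

Lemma difZ (h : M -> R) f x v : smooth_germ h x -> smooth_germ f x ->
  dif (fun y => h y *: f y) x v = dif h x v *: f x + h x *: dif f x v.
Proof.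
move=> /smooth_at_differentiable dh /smooth_at_differentiable df.
have xK := chartK (dom_center x).
by apply: etrans (diff_scale v dh df) _; rewrite /= xK.
Qed.

Lemma dif_cst (a : V) x v : dif (fun _ : M => a) x v = 0.
Proof. by rewrite /dif [X in diff _ X](_ : _ = cst a) // diff_cst. Qed.

Lemma dif_postcomp m (f : M -> 'rV[R]_m) (F : 'rV[R]_m -> V) x v :
  smooth_germ f x -> smooth_at F (f x) ->
  dif (F \o f) x v = 'd F (f x) (dif f x v).
Proof.
move=> /smooth_at_differentiable df sF.
have dF : differentiable F ((f \o param x) (chart x x)).
  by rewrite /= chartK; [exact: smooth_at_differentiable|exact: dom_center].
apply: etrans (congr1 (fun L : _ -> _ => L v) (diff_comp df dF)) _.
by rewrite /= chartK //; exact: dom_center.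
Qed.

End Basic.

Lemma diff_transition_id c x v : dom c x ->
  'd (chart c \o param c) (chart c x) v = v.
Proof.
move=> cx; have sc := smooth_at_differentiable (transition_smooth_at cx cx).
have xK : {near chart c x, chart c \o param c =1 id}.
  by apply: filterS (near_paramK cx) => u [].
have idE : 'd (id : 'rV[R]_n -> 'rV[R]_n) (chart c x) v = v by rewrite diff_val.
exact: etrans (congr1 (fun L : _ -> _ => L v) (near_eq_diff sc xK)) idE.
Qed.

(** The chain rule through the transition map.  When f is itself a chart, this
    is the cocycle rule for the components of a tangent vector. *)
Lemma diff_transition c d (V : normedModType R) (f : M -> V) x v :
  dom c x -> dom d x -> smooth_germ f x ->
  'd (f \o param c) (chart c x) v =
    'd (f \o param d) (chart d x) ('d (chart d \o param c) (chart c x) v).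
Proof.
move=> cx dx sf; have xx := dom_center x.
have dt := smooth_at_differentiable (transition_smooth_at cx dx).
have dfd : differentiable (f \o param d) ((chart d \o param c) (chart c x)).
  rewrite /= chartK //; apply: smooth_at_differentiable.
  exact: smooth_germ_chart sf.
have dfc := smooth_at_differentiable (smooth_germ_chart xx cx sf).
have fE : {near chart c x, f \o param c =1
    (f \o param d) \o (chart d \o param c)}.
  by apply: filterS (near_param cx (nbhs_dom dx)) => u du /=; rewrite chartK.
apply: etrans (congr1 (fun L : _ -> _ => L v) (near_eq_diff dfc fE)) _.
apply: etrans (congr1 (fun L : _ -> _ => L v) (diff_comp dt dfd)) _.
by rewrite /= chartK.
Qed.
End SmoothGerm.

(** * Vector fields along a map *)

Section AlongMap.
Variables (R : realType) (n m : nat).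
Variables (M : smooth_manifold R n) (N : smooth_manifold R m).
Implicit Types (f : M -> N) (x y : M) (c d : N) (V W : M -> 'rV[R]_m).

Lemma near_map f x (P : set N) : smooth_map f -> nbhs (f x) P ->
  \forall y \near x, P (f y).
Proof. by move=> [cf _]; exact: cf. Qed.

Lemma near_map_dom f x c : smooth_map f -> dom c (f x) ->
  \forall y \near x, dom c (f y).
Proof. by move=> sf cx; apply: (near_map sf); exact: nbhs_dom. Qed.

Lemma smooth_germ_chart_map f x d : smooth_map f -> dom d (f x) ->
  smooth_germ (chart d \o f) x.
Proof.
move=> [cf sf] dx; apply: (smooth_funP _ _).1 (sf d) _ dx.
by apply: open_comp => [y _|]; [exact: cf|exact: dom_open].
Qed.

Lemma near_comp_param f x (T : Type) (G : N -> T) : smooth_map f ->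
  {near x, (G \o param (f x)) \o (chart (f x) \o f) =1 G \o f}.
Proof.
move=> sf; apply: filterS (near_map_dom sf (dom_center (f x))) => y cy /=.
by rewrite chartK.
Qed.

Lemma smooth_germ_comp f x (V : normedModType R) (G : N -> V) :
  smooth_map f -> smooth_germ G (f x) -> smooth_germ (G \o f) x.
Proof.
move=> sf sG; have sc := smooth_germ_chart_map sf (dom_center (f x)).
apply: smooth_germ_eq (near_comp_param x G sf) _.
exact: (smooth_germ_postcomp (F := G \o param (f x)) sc sG).
Qed.

Lemma dif_comp f x (V : normedModType R) (G : N -> V) v :
  smooth_map f -> smooth_germ G (f x) ->
  dif (G \o f) x v = dif G (f x) (tangent_map f x v).
Proof.
move=> sf sG; have sc := smooth_germ_chart_map sf (dom_center (f x)).
rewrite -(dif_eq v _ (near_comp_param x G sf)).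
  exact: (dif_postcomp v (F := G \o param (f x)) sc sG).
exact: (smooth_germ_postcomp (F := G \o param (f x)) sc sG).
Qed.

(** The components are taken in the chart centred at f x; the choice is
    harmless by [smooth_section_chart]. *)
Definition smooth_section f V x : Prop :=
  smooth_germ (fun y => dif (chart (f x)) (f y) (V y)) x.

Lemma smooth_section_chart f V x c d : smooth_map f ->
  dom c (f x) -> dom d (f x) ->
  smooth_germ (fun y => dif (chart c) (f y) (V y)) x ->
  smooth_germ (fun y => dif (chart d) (f y) (V y)) x.
Proof.
move=> sf cx dx sV.
have sc := smooth_germ_chart_map sf cx.
apply: smooth_germ_eq (smooth_germ_diff sc (transition_smooth_at cx dx) sV).
apply: filterS (filterI (near_map_dom sf cx) (near_map_dom sf dx)) => y [cy dy].
exact: esym (diff_transition _ (dom_center _) cy (smooth_germ_chartP dy)).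
Qed.

Lemma smooth_alongP f (U : set M) V : smooth_map f -> open U ->
  smooth_along f U V <-> forall x, U x -> smooth_section f V x.
Proof.
move=> sf oU; have oI d : open (U `&` f @^-1` dom d).
  case: sf => cf _; apply: openI => //.
  by apply: open_comp => [y _|]; [exact: cf|exact: dom_open].
split=> [sV x Ux|sV d].
  apply: (smooth_funP _ (oI _)).1 (sV (f x)) _ _.
  by split => //; exact: dom_center.
apply/smooth_funP => // x [Ux dx].
by apply: smooth_section_chart (sV x Ux) => //; exact: dom_center.
Qed.

Lemma smooth_section_near f V x : smooth_map f -> smooth_section f V x ->
  \forall y \near x, smooth_section f V y.
Proof.
move=> sf sV.
apply: filterS (filterI (near_map_dom sf (dom_center (f x)))
  (smooth_germ_near sV)) => y [cy].
by apply: smooth_section_chart => //; exact: dom_center.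
Qed.

Lemma smooth_section_eq f V W x :
  {near x, V =1 W} -> smooth_section f V x -> smooth_section f W x.
Proof.
by move=> VW; apply: smooth_germ_eq; apply: filterS VW => y ->.
Qed.

Lemma smooth_sectionD f V W x : smooth_section f V x -> smooth_section f W x ->
  smooth_section f (fun y => V y + W y) x.
Proof.
move=> sV sW; apply: smooth_germ_eq (smooth_germD sV sW).
by apply: filterE => y; rewrite /dif linearD.
Qed.

Lemma smooth_sectionZ f (h : M -> R) V x :
  smooth_germ h x -> smooth_section f V x ->
  smooth_section f (fun y => h y *: V y) x.
Proof.
move=> sh sV; apply: smooth_germ_eq (smooth_germZ sh sV).
by apply: filterE => y; rewrite /dif linearZ.
Qed.

Lemma smooth_section0 f x : smooth_section f (fun=> 0) x.
Proof.
apply: smooth_germ_eq (smooth_germ_cst (0 : 'rV[R]_m) x).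
by apply: filterE => y; rewrite /dif linear0.
Qed.

(** The field with constant components w in the chart c.  A tangent vector at y
    is a row of components in the chart centred at y, hence the differential of
    the transition map. *)
Definition coord_field c (w : 'rV[R]_m) (y : N) : 'rV[R]_m :=
  'd (chart y \o param c) (chart c y) w.

Lemma dif_coord_field c d w z : dom c z -> dom d z ->
  dif (chart d) z (coord_field c w z) = 'd (chart d \o param c) (chart c z) w.
Proof.
move=> cz dz.
exact: esym (diff_transition w cz (dom_center z) (smooth_germ_chartP dz)).
Qed.

Lemma dif_coord_field_self c w z : dom c z ->
  dif (chart c) z (coord_field c w z) = w.
Proof.
by move=> cz; apply: etrans (dif_coord_field w cz cz) (diff_transition_id w cz).
Qed.

Lemma dif_chart_self (z : N) v : dif (chart z) z v = v.
Proof. exact: diff_transition_id (dom_center z). Qed.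

Lemma coord_fieldK c z v : dom c z -> coord_field c (dif (chart c) z v) z = v.
Proof.
move=> cz; have zz := dom_center z; have sz := smooth_germ_chartP zz.
rewrite /coord_field /dif -(diff_transition v zz cz sz).
exact: dif_chart_self.
Qed.

Lemma coord_field_center c w : coord_field c w c = w.
Proof. exact: diff_transition_id (dom_center c). Qed.

Lemma coord_field_row c w z :
  coord_field c w z = \sum_j w 0 j *: coord_field c (delta_mx 0 j) z.
Proof. exact: diff_row. Qed.

Lemma smooth_section_coord_field f c w x : smooth_map f -> dom c (f x) ->
  smooth_section f (coord_field c w \o f) x.
Proof.
move=> sf cx; have sc := smooth_germ_chart_map sf cx.
have xx := dom_center (f x).
have sw := @smooth_germ_cst R n M _ w x.
apply: smooth_germ_eq (smooth_germ_diff sc (transition_smooth_at cx xx) sw).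
apply: filterS (filterI (near_map_dom sf cx) (near_map_dom sf xx)) => y [cy dy].
exact: esym (dif_coord_field w cy dy).
Qed.

(** Near x every section along f is a combination of the pull-backs of the
    coordinate fields around f x, with smooth functions as coefficients.  On
    these pull-backs a pulled-back connection is known explicitly. *)
Lemma section_ind f x (P : (M -> 'rV[R]_m) -> Prop) : smooth_map f ->
  (forall V W, smooth_section f V x -> {near x, V =1 W} -> P V -> P W) ->
  (forall V W, smooth_section f V x -> smooth_section f W x ->
     P V -> P W -> P (fun y => V y + W y)) ->
  (forall (h : M -> R) V, smooth_germ h x -> smooth_section f V x ->
     P V -> P (fun y => h y *: V y)) ->
  P (fun=> 0) ->
  (forall j, P (coord_field (f x) (delta_mx 0 j) \o f)) ->
  forall V, smooth_section f V x -> P V.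
Proof.
move=> sf Peq PD PZ P0 PE V sV; have xx := dom_center (f x).
pose E (j : 'I_m) := coord_field (f x) (delta_mx 0 j) \o f.
(* The coefficients are the components of V in the chart centred at f x. *)
pose v j y : R := (dif (chart (f x)) (f y) (V y)) 0 j.
have sE j : smooth_section f (E j) x by exact: smooth_section_coord_field.
have sv j : smooth_germ (v j) x by exact: smooth_at_coord sV.
have Psum (s : seq 'I_m) :
    smooth_section f (fun y => \sum_(j <- s) v j y *: E j y) x /\
    P (fun y => \sum_(j <- s) v j y *: E j y).
  elim: s => [|j s [sIH PIH]].
    under eq_fun do rewrite big_nil.
    by split; [exact: smooth_section0|exact: P0].
  under eq_fun do rewrite big_cons.
  have svE := smooth_sectionZ (sv j) (sE j).
  split; first exact: (smooth_sectionD svE sIH).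
  exact: (PD _ _ svE sIH (PZ _ _ (sv j) (sE j) (PE _)) PIH).
have [sS PS] := Psum (index_enum 'I_m).
apply: Peq sS _ PS.
apply: filterS (near_map_dom sf xx) => y xy.
by rewrite -[RHS](coord_fieldK _ xy) [RHS]coord_field_row.
Qed.

End AlongMap.

(** * Connections along a map *)

Lemma smooth_map_id (R : realType) (n : nat) (M : smooth_manifold R n) :
  smooth_map (@id M).
Proof.
split=> [x|d]; first by move=> P.
apply/smooth_funP => [|x dx]; first exact: dom_open.
exact: smooth_germ_chartP.
Qed.

(** Tensors, metrics and connections are only known to satisfy the proposition
    [linear]; these are the usual rules for such maps. *)
Section LinearRelations.
Variables (R : realType) (U W : lmodType R) (F : U -> W).
Hypothesis linF : linear F.

Lemma linear_rel_add u w : F (u + w) = F u + F w.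
Proof. by have := linF 1 u w; rewrite !scale1r. Qed.

Lemma linear_rel0 : F 0 = 0.
Proof. by apply: (addrI (F 0)); rewrite -linear_rel_add !addr0. Qed.

Lemma linear_rel_scale a u : F (a *: u) = a *: F u.
Proof. by have := linF a u 0; rewrite !addr0 linear_rel0 addr0. Qed.
End LinearRelations.

Section Metric.
Variables (R : realType) (n : nat) (M : smooth_manifold R n).
Variable g : M -> 'rV[R]_n -> 'rV[R]_n -> R.
Hypothesis mg : riemannian_metric g.
Implicit Types (x : M) (u v w : 'rV[R]_n).

Lemma metricDr x w u v : g x w (u + v) = g x w u + g x w v.
Proof. exact: (linear_rel_add (W := R^o) (Defs.metric_linear mg x w)). Qed.

Lemma metricZr x w a u : g x w (a *: u) = a * g x w u.
Proof. exact: (linear_rel_scale (W := R^o) (Defs.metric_linear mg x w)). Qed.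

Lemma metricDl x u v w : g x (u + v) w = g x u w + g x v w.
Proof. by rewrite !(Defs.metric_sym mg x _ w) metricDr. Qed.

Lemma metricZl x a u w : g x (a *: u) w = a * g x u w.
Proof. by rewrite !(Defs.metric_sym mg x _ w) metricZr. Qed.

Lemma metricBl x u v w : g x (u - v) w = g x u w - g x v w.
Proof. by rewrite -scaleN1r metricDl metricZl mulN1r. Qed.

Lemma metric_definite x u : g x u u = 0 -> u = 0.
Proof.
move=> gu; apply/eqP; apply: contraT => /(Defs.metric_pos mg x).
by rewrite gu ltxx.
Qed.
End Metric.

Section Connection.
Variables (R : realType) (n m : nat).
Variables (M : smooth_manifold R n) (N : smooth_manifold R m).
Variables (f : M -> N) (D : (M -> 'rV[R]_m) -> M -> 'rV[R]_n -> 'rV[R]_m).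
Hypotheses (sf : smooth_map f) (cD : connection_along f D).
Implicit Types (V W : M -> 'rV[R]_m) (x : M) (v : 'rV[R]_n).

(** The axioms of a connection refer to open sets.  Smoothness at x provides an
    open set around x on which all the sections in play are smooth, so that the
    axioms hold for germs. *)
Lemma connection_eq V W x v :
  smooth_section f V x -> {near x, V =1 W} -> D V x v = D W x v.
Proof.
move=> sV VW.
have : nbhs x [set y | smooth_section f V y /\ V y = W y].
  exact: filterI (smooth_section_near sf sV) VW.
rewrite nbhsE => -[U [oU Ux] UP].
apply: (conn_local cD v oU _ _ _ Ux).
- by apply/(smooth_alongP _ sf oU) => y /UP[].
- apply/(smooth_alongP _ sf oU) => y Uy; have [sVy _] := UP y Uy.
  apply: smooth_section_eq sVy.
  by apply: filterS (open_nbhs_nbhs (conj oU Uy)) => z /UP[].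
- by move=> y /UP[].
Qed.

Lemma connectionD V W x v : smooth_section f V x -> smooth_section f W x ->
  D (fun y => V y + W y) x v = D V x v + D W x v.
Proof.
move=> sV sW.
have : nbhs x [set y | smooth_section f V y /\ smooth_section f W y].
  exact: filterI (smooth_section_near sf sV) (smooth_section_near sf sW).
rewrite nbhsE => -[U [oU Ux] UP].
apply: (conn_add cD v oU _ _ Ux).
  by apply/(smooth_alongP _ sf oU) => y /UP[].
by apply/(smooth_alongP _ sf oU) => y /UP[].
Qed.

Lemma connectionZ (h : M -> R) V x v :
  smooth_germ h x -> smooth_section f V x ->
  D (fun y => h y *: V y) x v = dif h x v *: V x + h x *: D V x v.
Proof.
move=> sh sV.
have : nbhs x [set y | smooth_germ h y /\ smooth_section f V y].
  exact: filterI (smooth_germ_near sh) (smooth_section_near sf sV).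
rewrite nbhsE => -[U [oU Ux] UP].
apply: (conn_leibniz cD v oU _ _ Ux).
  by apply/(smooth_funP _ oU) => y /UP[].
by apply/(smooth_alongP _ sf oU) => y /UP[].
Qed.

Lemma connection_cstZ (a : R) V x v : smooth_section f V x ->
  D (fun y => a *: V y) x v = a *: D V x v.
Proof.
move=> sV; rewrite connectionZ //; last exact: smooth_germ_cst.
by rewrite dif_cst scale0r add0r.
Qed.

Lemma connection0 x v : D (fun=> 0) x v = 0.
Proof.
have /= := connection_cstZ 0 v (smooth_section0 f x).
by rewrite !scale0r.
Qed.

End Connection.

(** * Pull-back of a connection *)

Section Pullback.
Variables (R : realType) (n m : nat).
Variables (M : smooth_manifold R n) (N : smooth_manifold R m) (f : M -> N).
Variable nabla : (N -> 'rV[R]_m) -> N -> 'rV[R]_m -> 'rV[R]_m.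
Variable D : (M -> 'rV[R]_m) -> M -> 'rV[R]_n -> 'rV[R]_m.
Hypotheses (sf : smooth_map f) (pD : pullback_connection f nabla D).
Implicit Types (V W : M -> 'rV[R]_m) (x : M) (v : 'rV[R]_n).

Local Notation frame x j := (coord_field (f x) (delta_mx 0 j)).
Let cD : connection_along f D := pD.1.

Lemma smooth_field_coord_field (c : N) w :
  smooth_field (dom c) (coord_field c w).
Proof.
apply/(smooth_alongP _ (@smooth_map_id _ _ N) (dom_open c)) => y cy.
exact: (smooth_section_coord_field w (@smooth_map_id _ _ N) cy).
Qed.

Lemma pullback_frame x w v : D (coord_field (f x) w \o f) x v =
  nabla (coord_field (f x) w) (f x) (tangent_map f x v).
Proof.
exact: (pD.2 _ _ x v (dom_open _) (smooth_field_coord_field _ w)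
  (dom_center (f x))).
Qed.

Lemma smooth_section_frame x w : smooth_section f (coord_field (f x) w \o f) x.
Proof. exact: smooth_section_coord_field (dom_center _). Qed.

(** The expression of a covariant derivative by Christoffel symbols: the
    derivative of the components and a term of order zero in V. *)
Lemma pullback_coordE V x v : smooth_section f V x ->
  D V x v = dif (fun y => dif (chart (f x)) (f y) (V y)) x v +
    \sum_j V x 0 j *: nabla (frame x j) (f x) (tangent_map f x v).
Proof.
move: V; apply: section_ind => // [V W sV VW|V W sV sW|h V sh sV||j].
- rewrite -(connection_eq sf cD v sV VW) (nbhs_singleton VW).
  rewrite (dif_eq v sV (g := fun y => dif (chart (f x)) (f y) (W y))) //.
  by apply: filterS VW => y ->.
- move=> EV EW; rewrite (connectionD sf cD v sV sW) EV EW addrACA.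
  congr (_ + _).
    apply: etrans (esym (difD v sV sW)) _.
    apply: (congr1 (fun F : M -> _ => dif F x v)); apply/funext => y.
    exact: esym (linearD _ _ _).
  by rewrite -big_split; apply: eq_bigr => j _; rewrite mxE scalerDl.
- move=> EV; rewrite (connectionZ sf cD v sh sV) EV scalerDr addrA.
  congr (_ + _).
    rewrite -[X in _ *: X + _](dif_chart_self (f x) (V x)).
    apply: etrans (esym (difZ v sh sV)) _.
    apply: (congr1 (fun F : M -> _ => dif F x v)); apply/funext => y.
    exact: esym (linearZZ _ _ _).
  by rewrite scaler_sumr; apply: eq_bigr => j _; rewrite mxE scalerA.
- rewrite (connection0 sf cD) big1 ?addr0 => [|j _].
  2: by rewrite mxE scale0r.
  rewrite [X in dif X](_ : _ = fun=> 0) ?dif_cst //.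
  by apply/funext => y; rewrite /dif linear0.
- rewrite pullback_frame.
  rewrite -(dif_eq v (smooth_germ_cst (delta_mx 0 j : 'rV[R]_m) x)); last first.
    apply: filterS (near_map_dom sf (dom_center (f x))) => y xy.
    exact: esym (dif_coord_field_self _ xy).
  rewrite dif_cst add0r (bigD1 j) //= big1 => [|k kj];
    rewrite coord_field_center mxE eqxx.
    by rewrite eqxx scale1r addr0.
  by rewrite (negbTE kj) scale0r.
Qed.

Section Metric.
Variable gN : N -> 'rV[R]_m -> 'rV[R]_m -> R.
Hypotheses (mg : riemannian_metric gN) (lc : levi_civita gN nabla).

(* Smoothness is carried along because the induction differentiates sums and
   products of such functions. *)
Let pairing x v V W : Prop :=
  smooth_germ (fun y => gN (f y) (V y) (W y)) x /\
  dif (fun y => gN (f y) (V y) (W y)) x v =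
    gN (f x) (D V x v) (W x) + gN (f x) (V x) (D W x v).

Let pairing_sym x v V W : pairing x v V W -> pairing x v W V.
Proof.
rewrite /pairing; under eq_fun do rewrite (Defs.metric_sym mg).
move=> [sVW ->]; split=> //; rewrite addrC.
by congr (_ + _); exact: Defs.metric_sym mg _ _ _.
Qed.

Let pairing_frame x v W : smooth_section f W x ->
  (forall j, pairing x v (frame x j \o f) W) ->
  forall V, smooth_section f V x -> pairing x v V W.
Proof.
move=> sW PE.
apply: section_ind => // [V V' sV VV'|V V' sV sV'|h V sh sV|].
- have gVV' : {near x, (fun y => gN (f y) (V y) (W y)) =1
      (fun y => gN (f y) (V' y) (W y))} by apply: filterS VV' => y ->.
  move=> [sg EV]; split; first exact: smooth_germ_eq sg.
  rewrite -(dif_eq v sg gVV') EV -(nbhs_singleton VV').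
  by rewrite (connection_eq sf cD v sV VV').
- move=> [sg EV] [sg' EV']; rewrite /pairing.
  under eq_fun do rewrite (metricDl mg).
  split; first exact: smooth_germD.
  by rewrite difD // EV EV' (connectionD sf cD v sV sV') !(metricDl mg) addrACA.
- move=> [sg EV]; rewrite /pairing; under eq_fun do rewrite (metricZl mg).
  split; first exact: smooth_germZ sh sg.
  have EZ : dif (fun y => h y * gN (f y) (V y) (W y)) x v =
      dif h x v * gN (f x) (V x) (W x) +
      h x * dif (fun y => gN (f y) (V y) (W y)) x v by exact: difZ.
  rewrite EZ EV (connectionZ sf cD v sh sV) (metricDl mg) !(metricZl mg).
  by ring.
- have g0 y w : gN y 0 w = 0 by rewrite -(scale0r 0) (metricZl mg) mul0r.
  rewrite /pairing; under eq_fun do rewrite g0.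
  split; first exact: smooth_germ_cst.
  by rewrite dif_cst (connection0 sf cD) !g0 addr0.
Qed.

(** Both sides obey the same Leibniz rule in V and in W.  Applying [section_ind]
    to V and then, by symmetry, to W leaves pairs of coordinate fields, for
    which this is the chain rule for f and the compatibility of [nabla] with the
    metric. *)
Lemma pullback_metric V W x v : smooth_section f V x -> smooth_section f W x ->
  dif (fun y => gN (f y) (V y) (W y)) x v =
    gN (f x) (D V x v) (W x) + gN (f x) (V x) (D W x v).
Proof.
move=> sV sW; suff [] : pairing x v V W by [].
apply: pairing_frame => // j; apply: pairing_sym.
apply: pairing_frame => // [|k]; first exact: smooth_section_frame.
have oc := dom_open (f x); have xx := dom_center (f x).
have sE w := smooth_field_coord_field (f x) w.
have sg := (smooth_funP _ oc).1 (metric_smooth mg oc (sE (delta_mx 0 k))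
  (sE (delta_mx 0 j))) _ xx.
split; first exact: (smooth_germ_comp sf sg).
apply: etrans (dif_comp v sf sg) _.
rewrite !pullback_frame.
exact: (lc_metric lc (tangent_map f x v) oc (sE _) (sE _) xx).
Qed.
End Metric.

(** The smoothness of J V is proved together with the identity, because the
    rules for D apply to smooth sections only. *)
Lemma pullback_parallel (J : N -> 'rV[R]_m -> 'rV[R]_m) V x v :
  tensor11 J ->
  (forall U Y y w, open U -> smooth_field U Y -> U y ->
     nabla (fun z => J z (Y z)) y w - J y (nabla Y y w) = 0) ->
  smooth_section f V x ->
  smooth_section f (fun y => J (f y) (V y)) x /\
  D (fun y => J (f y) (V y)) x v = J (f x) (D V x v).
Proof.
move=> [linJ smJ] parJ.
have JD y u w := linear_rel_add (linJ y) u w.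
have JZ y a u := linear_rel_scale (linJ y) a u.
have J0 y := linear_rel0 (linJ y).
move: V; apply: section_ind => // [V W sV VW|V W sV sW|h V sh sV||j].
- move=> [sJ EJ]; have JVW : {near x, (fun y => J (f y) (V y)) =1
      (fun y => J (f y) (W y))} by apply: filterS VW => y ->.
  split; first exact: smooth_section_eq sJ.
  by rewrite -(connection_eq sf cD v sJ JVW) EJ (connection_eq sf cD v sV VW).
- move=> [sJV EV] [sJW EW]; under eq_fun do rewrite JD.
  split; first exact: smooth_sectionD.
  by rewrite (connectionD sf cD v sJV sJW) (connectionD sf cD v sV sW) JD EV EW.
- move=> [sJV EV]; under eq_fun do rewrite JZ.
  split; first exact: smooth_sectionZ.
  by rewrite (connectionZ sf cD v sh sJV) (connectionZ sf cD v sh sV) JD !JZ EV.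
- under eq_fun do rewrite J0.
  by split; [exact: smooth_section0|rewrite (connection0 sf cD) J0].
have oc := dom_open (f x); have xx := dom_center (f x).
have sE := smooth_field_coord_field (f x) (delta_mx 0 j).
have sJE := smJ _ _ oc sE.
split.
  have sJEx : smooth_section (@id N) (fun z => J z (frame x j z)) (f x).
    exact: (smooth_alongP _ (@smooth_map_id _ _ N) oc).1 sJE _ xx.
  exact: (smooth_germ_comp sf sJEx).
rewrite pullback_frame -(subr0_eq (parJ _ _ _ _ oc sE xx)).
exact: (pD.2 _ _ _ _ oc sJE xx).
Qed.

(** The Christoffel symbols are symmetric because coordinate fields commute and
    the connection has no torsion. *)
Lemma nabla_frame_sym (gN : N -> 'rV[R]_m -> 'rV[R]_m -> R) x (a b : 'rV[R]_m) :
  levi_civita gN nabla ->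
  \sum_j a 0 j *: nabla (frame x j) (f x) b =
  \sum_j b 0 j *: nabla (frame x j) (f x) a.
Proof.
move=> lc; have oc := dom_open (f x); have xx := dom_center (f x).
have sE w := smooth_field_coord_field (f x) w.
have lin w : linear (nabla (coord_field (f x) w) (f x)).
  exact: (conn_linear (lc_connection lc) oc (sE w) xx).
have nE w (u : 'rV[R]_m) : nabla (coord_field (f x) w) (f x) u =
    \sum_k u 0 k *: nabla (coord_field (f x) w) (f x) (delta_mx 0 k).
  rewrite {1}[u]row_sum_delta; elim/big_rec2: _ => [|k u1 u2 _ <-].
    exact: linear_rel0 (lin w).
  by rewrite (linear_rel_add (lin w)) (linear_rel_scale (lin w)).
have sym j k : nabla (frame x j) (f x) (delta_mx 0 k) =
    nabla (frame x k) (f x) (delta_mx 0 j).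
  have := lc_torsion_free lc oc (sE (delta_mx 0 k)) (sE (delta_mx 0 j)) xx.
  have br0 w u :
      dif (fun y => dif (chart (f x)) y (coord_field (f x) w y)) (f x) u = 0.
    rewrite -(dif_eq u (smooth_germ_cst w (f x))) ?dif_cst //.
    apply: filterS (nbhs_dom xx) => y xy.
    exact: esym (dif_coord_field_self _ xy).
  by rewrite /lie_bracket !br0 subrr !coord_field_center => /subr0_eq.
under eq_bigr do rewrite nE scaler_sumr.
under [RHS]eq_bigr do rewrite nE scaler_sumr.
rewrite exchange_big; apply: eq_bigr => j _; apply: eq_bigr => k _.
by rewrite !scalerA mulrC sym.
Qed.

(** On the right the differential of one fixed map is taken at a moving point,
    which is the form that [smooth_germ_diff] and [diff_second] apply to. *)
Lemma near_dif_tangent_map (Y : M -> 'rV[R]_n) x :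
  {near x, (fun y => dif (chart (f x)) (f y) (tangent_map f y (Y y))) =1
    (fun y => 'd ((chart (f x) \o f) \o param x) (chart x y)
                 (dif (chart x) y (Y y)))}.
Proof.
have cc := dom_center (f x); have xx := dom_center x.
have sc := smooth_germ_near (smooth_germ_chart_map sf cc).
apply: filterS (filterI (near_map_dom sf cc) (filterI (nbhs_dom xx) sc)).
move=> y [cy [xy scy]].
apply: etrans (esym (dif_comp (Y y) sf (smooth_germ_chartP cy))) _.
exact: (diff_transition (Y y) (dom_center y) xy scy).
Qed.

Lemma smooth_section_tangent_map (Y : M -> 'rV[R]_n) x :
  smooth_section (@id M) Y x ->
  smooth_section f (fun y => tangent_map f y (Y y)) x.
Proof.
move=> sY; have cc := dom_center (f x); have xx := dom_center x.
have sc := smooth_germ_chart_map sf cc.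
apply: smooth_germ_eq (smooth_germ_diff (smooth_germ_chartP xx) sc sY).
by apply: filterS (near_dif_tangent_map Y x) => y ->.
Qed.

(** In coordinates D_X (df Y) is the sum of df applied to the derivative of Y
    along X, of the second derivative of f along X and Y, and of a Christoffel
    term.  The last two are symmetric in X and Y, and the first ones differ by
    df [X, Y]. *)
Lemma pullback_torsion_free (gN : N -> 'rV[R]_m -> 'rV[R]_m -> R)
    (X Y : M -> 'rV[R]_n) x :
  levi_civita gN nabla ->
  smooth_section (@id M) X x -> smooth_section (@id M) Y x ->
  D (fun y => tangent_map f y (Y y)) x (X x)
  - D (fun y => tangent_map f y (X y)) x (Y x) =
  tangent_map f x (lie_bracket X Y x).
Proof.
move=> lc sX sY; have cc := dom_center (f x); have xx := dom_center x.
have sc : smooth_at ((chart (f x) \o f) \o param x) (chart x x).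
  exact: smooth_germ_chart_map sf cc.
have key (Z : M -> 'rV[R]_n) v : smooth_section (@id M) Z x ->
    dif (fun y => dif (chart (f x)) (f y) (tangent_map f y (Z y))) x v =
    'd ((chart (f x) \o f) \o param x) (chart x x)
       (dif (fun y => dif (chart x) y (Z y)) x v) +
    'D_(Z x) ('D_v ((chart (f x) \o f) \o param x)) (chart x x).
  move=> sZ.
  rewrite (dif_eq v (smooth_section_tangent_map sZ) (near_dif_tangent_map Z x)).
  have sG := smooth_germ_diff (smooth_germ_chartP xx) sc sZ.
  have GE : {near chart x x,
      (fun y => 'd ((chart (f x) \o f) \o param x) (chart x y)
                 (dif (chart x) y (Z y))) \o param x =1
      (fun u => 'd ((chart (f x) \o f) \o param x) u
                 (dif (chart x) (param x u) (Z (param x u))))}.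
    by apply: filterS (near_paramK xx) => u [_ uK]; rewrite /= uK.
  apply: etrans (congr1 (fun L : _ -> _ => L v)
    (near_eq_diff (smooth_at_differentiable sG) GE)) _.
  pose Zx u := dif (chart x) (param x u) (Z (param x u)).
  have Zx0 : Zx (chart x x) = Z x by rewrite /Zx (chartK xx) dif_chart_self.
  by rewrite -Zx0; exact: (diff_second (Z := Zx) v sc sZ).
have cancelr (a b c : 'rV[R]_m) : (a + c) - (b + c) = a - b.
  by rewrite opprD addrACA subrr addr0.
rewrite !pullback_coordE; try exact: smooth_section_tangent_map.
rewrite !key // (nabla_frame_sym _ _ _ lc) cancelr.
rewrite (smooth_at_schwarz (X x) (Y x) sc) cancelr.
by rewrite /lie_bracket /tangent_map [RHS]linearB.
Qed.
End Pullback.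

(** * The characteristic field of the hypersurface *)

Section Hypersurface.
Variables (R : realType) (n p q : nat) (N : smooth_manifold R n.+1).
Variable gN : N -> 'rV[R]_n.+1 -> 'rV[R]_n.+1 -> R.
Variable nablaN : (N -> 'rV[R]_n.+1) -> N -> 'rV[R]_n.+1 -> 'rV[R]_n.+1.
Variable J : N -> 'rV[R]_n.+1 -> 'rV[R]_n.+1.
Variables (M : smooth_manifold R n) (i : M -> N) (nu : M -> 'rV[R]_n.+1).
Variable g : M -> 'rV[R]_n -> 'rV[R]_n -> R.
Variables (phi : M -> 'rV[R]_n -> 'rV[R]_n) (eta : M -> 'rV[R]_n -> R).
Variable xi : M -> 'rV[R]_n.
Variable D : (M -> 'rV[R]_n.+1) -> M -> 'rV[R]_n -> 'rV[R]_n.+1.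
Variable A : M -> 'rV[R]_n -> 'rV[R]_n.
Hypothesis LM : locally_metallic p q gN nablaN J.
Hypothesis QH : quadratic_metric_hypersurface p q gN J i nu g phi eta xi.
Hypothesis pD : pullback_connection i nablaN D.
Hypothesis AD : shape_operator i D nu A.
Implicit Types (x : M) (u v w : 'rV[R]_n).

Let si : smooth_map i := (qh_immersion QH).1.
Let mgN : riemannian_metric gN := mr_metric (lm_metallic LM).
Let lcN : levi_civita gN nablaN := lm_levi_civita LM.

Let sD x (u v : 'rV[R]_n) :
  tangent_map i x (u + v) = tangent_map i x u + tangent_map i x v.
Proof. exact: linearD. Qed.

Let sZ x a (u : 'rV[R]_n) :
  tangent_map i x (a *: u) = a *: tangent_map i x u.
Proof. exact: linearZZ. Qed.

Let smooth_nu x : smooth_section i nu x.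
Proof. exact: (smooth_alongP _ si openT).1 (qh_nu_smooth QH) x I. Qed.

Let smooth_xi x : smooth_section (@id M) xi x.
Proof.
exact: (smooth_alongP _ (@smooth_map_id _ _ M) openT).1
  (aq_xi_smooth (qh_structure QH)) x I.
Qed.

Let smooth_dxi x : smooth_section i (fun y => tangent_map i y (xi y)) x.
Proof. exact: smooth_section_tangent_map. Qed.

(** Obtained by differentiating gN (nu, di Y) = 0. *)
Lemma second_fundamental_form (Y : M -> 'rV[R]_n) x v :
  smooth_section (@id M) Y x ->
  g x (A x v) (Y x) = gN (i x) (nu x) (D (fun y => tangent_map i y (Y y)) x v).
Proof.
move=> sY; have sdY := smooth_section_tangent_map si sY.
have := pullback_metric si pD mgN lcN v (smooth_nu x) sdY.
under eq_fun do rewrite (qh_nu_normal QH).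
rewrite dif_cst AD -scaleN1r (metricZl mgN) -(qh_induced QH) mulN1r addrC.
by move=> /esym/subr0_eq.
Qed.

(** By [second_fundamental_form] the two sides differ by the product of nu with
    di [X, Y], for fields X and Y extending u and v; this vector is tangent. *)
Lemma shape_operator_sym x u v : g x (A x u) v = g x (A x v) u.
Proof.
have sid := @smooth_map_id _ _ M; have xx := dom_center x.
have sE w : smooth_section (@id M) (coord_field x w) x.
  exact: (smooth_section_coord_field w sid xx).
have E w w' : g x (A x w) w' = gN (i x) (nu x)
    (D (fun y => tangent_map i y (coord_field x w' y)) x (coord_field x w x)).
  by rewrite -second_fundamental_form // !coord_field_center.
rewrite !E; apply/eqP; rewrite -subr_eq0 -mulN1r -(metricZr mgN) scaleN1r.
rewrite -(metricDr mgN) (pullback_torsion_free si pD lcN (sE u) (sE v)).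
by rewrite (qh_nu_normal QH).
Qed.

(** Obtained by differentiating J nu = q di(xi) + p nu, as J is parallel. *)
Lemma derivative_xi x v :
  q%:R *: D (fun y => tangent_map i y (xi y)) x v =
  tangent_map i x (p%:R *: A x v - phi x (A x v)) - eta x (A x v) *: nu x.
Proof.
have tJ := metallic_tensor (mr_structure (lm_metallic LM)).
have [_ DJ] := pullback_parallel si pD v tJ (lm_parallel LM) (smooth_nu x).
move: DJ; under eq_fun do rewrite (qh_J_nu QH).
rewrite (connectionD si pD.1) ?(connection_cstZ si pD.1) //; last 2 first.
- exact: smooth_sectionZ (smooth_germ_cst _ _) (smooth_dxi x).
- exact: smooth_sectionZ (smooth_germ_cst _ _) (smooth_nu x).
rewrite AD -[- tangent_map _ _ _]scaleN1r (linear_rel_scale (tJ.1 _)).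
rewrite (qh_J_tangent QH) => E.
(* The derivative of p nu is added to both sides. *)
apply: (addIr (p%:R *: (-1 *: tangent_map i x (A x v)))); rewrite E.
rewrite sD sZ -[- phi x _]scaleN1r sZ !scaleN1r scalerN opprD.
by rewrite -!addrA [RHS]addrC -!addrA addNr addr0.
Qed.

(** The brackets with xi are differences of covariant derivatives.  Their parts
    along xi cancel with the derivative of g (X, Y) because D preserves the
    metric; the rest is given by [derivative_xi], whose normal component is
    orthogonal to di X and di Y. *)
Lemma killing_expression X Y x :
  smooth_section (@id M) X x -> smooth_section (@id M) Y x ->
  q%:R * (dif (fun y => g y (X y) (Y y)) x (xi x)
    - g x (lie_bracket xi X x) (Y x) - g x (X x) (lie_bracket xi Y x)) =
  g x ((2 * p)%:R *: A x (X x) - (phi x (A x (X x)) + A x (phi x (X x)))) (Y x).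
Proof.
move=> sX sY.
have gB u v w : g x (u - v) w = g x u w - g x v w.
  by rewrite !(qh_induced QH) /tangent_map /dif linearB (metricBl mgN).
have gZ a u w : g x (a *: u) w = a * g x u w.
  by rewrite !(qh_induced QH) sZ (metricZl mgN).
have gsym u w : g x u w = g x w u.
  by rewrite !(qh_induced QH); exact: (Defs.metric_sym mgN).
have qDxi u w : q%:R * gN (i x) (D (fun y => tangent_map i y (xi y)) x u)
    (tangent_map i x w) = p%:R * g x (A x u) w - g x (phi x (A x u)) w.
  rewrite -(metricZl mgN) derivative_xi (metricBl mgN) (metricZl mgN).
  by rewrite (qh_nu_normal QH) mulr0 subr0 -(qh_induced QH) gB gZ.
have bracketE (Z W : M -> 'rV[R]_n) : smooth_section (@id M) Z x ->
    g x (lie_bracket xi Z x) (W x) =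
    gN (i x) (D (fun y => tangent_map i y (Z y)) x (xi x))
      (tangent_map i x (W x)) -
    gN (i x) (D (fun y => tangent_map i y (xi y)) x (Z x))
      (tangent_map i x (W x)).
  move=> sZ'; rewrite (qh_induced QH).
  rewrite -(pullback_torsion_free si pD lcN (smooth_xi x) sZ').
  by rewrite (metricBl mgN).
rewrite (gsym (X x)) !bracketE //; under eq_fun do rewrite (qh_induced QH).
rewrite (pullback_metric si pD mgN lcN (xi x)
  (smooth_section_tangent_map si sX) (smooth_section_tangent_map si sY)).
rewrite (Defs.metric_sym mgN _ (tangent_map i x (X x))).
set a := gN _ (D (fun y => tangent_map i y (X y)) _ _) _.
set b := gN _ (D (fun y => tangent_map i y (Y y)) _ _) _.
set c := gN _ _ _; set d := gN _ _ _.
(* The products a and b cancel; those with D (di xi) remain. *)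
rewrite (_ : _ - _ - _ = c + d); last by ring.
rewrite mulrDr !qDxi gB gZ natrM (shape_operator_sym x (Y x)).
have -> : g x (phi x (A x (Y x))) (X x) = g x (A x (phi x (X x))) (Y x).
  by rewrite (aq_phi_sym (qh_structure QH)) shape_operator_sym.
have -> : g x (phi x (A x (X x)) + A x (phi x (X x))) (Y x) =
    g x (phi x (A x (X x))) (Y x) + g x (A x (phi x (X x))) (Y x).
  by rewrite !(qh_induced QH) sD (metricDl mgN).
by ring.
Qed.
End Hypersurface.

Theorem proposition4p4 (R : realType) (n p q : nat)
    (N : smooth_manifold R n.+1)
    (gN : N -> 'rV[R]_n.+1 -> 'rV[R]_n.+1 -> R)
    (nablaN : (N -> 'rV[R]_n.+1) -> N -> 'rV[R]_n.+1 -> 'rV[R]_n.+1)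
    (J : N -> 'rV[R]_n.+1 -> 'rV[R]_n.+1)
    (M : smooth_manifold R n) (i : M -> N) (nu : M -> 'rV[R]_n.+1)
    (g : M -> 'rV[R]_n -> 'rV[R]_n -> R)
    (nabla : (M -> 'rV[R]_n) -> M -> 'rV[R]_n -> 'rV[R]_n)
    (phi : M -> 'rV[R]_n -> 'rV[R]_n) (eta : M -> 'rV[R]_n -> R)
    (xi : M -> 'rV[R]_n)
    (D : (M -> 'rV[R]_n.+1) -> M -> 'rV[R]_n -> 'rV[R]_n.+1)
    (A : M -> 'rV[R]_n -> 'rV[R]_n) :
  locally_metallic p q gN nablaN J ->
  quadratic_metric_hypersurface p q gN J i nu g phi eta xi ->
  levi_civita g nabla ->
  pullback_connection i nablaN D ->
  shape_operator i D nu A ->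
  (killing g xi <->
   forall x v, phi x (A x v) + A x (phi x v) = (2 * p)%:R *: A x v).
Proof.
move=> LM QH _ pD AD.
have key := killing_expression LM QH pD AD.
have sid := @smooth_map_id _ _ M.
have mgN := mr_metric (lm_metallic LM).
have q0 : q%:R != 0 :> R.
  by rewrite pnatr_eq0 -lt0n (metallic_q (mr_structure (lm_metallic LM))).
have gE u v x := qh_induced QH x u v.
have d0 x : tangent_map i x 0 = 0 by exact: linear0.
split=> [kil x v|phiA U X Y x oU sX sY Ux]; last first.
  have sXx := (smooth_alongP _ sid oU).1 sX x Ux.
  have sYx := (smooth_alongP _ sid oU).1 sY x Ux.
  apply: (mulfI q0); rewrite mulr0 (key _ _ _ sXx sYx) phiA subrr gE.
  by rewrite d0 -(scale0r 0) (metricZl mgN) mul0r.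
(* The defect of the identity is paired with itself, after v and the defect
   have been extended to coordinate fields. *)
pose w := (2 * p)%:R *: A x v - (phi x (A x v) + A x (phi x v)).
have xx := dom_center x; have oc := dom_open x.
have sE u := smooth_field_coord_field x u.
have sEx u : smooth_section (@id M) (coord_field x u) x.
  exact: (smooth_section_coord_field u sid xx).
have := key _ _ _ (sEx v) (sEx w).
rewrite (kil _ _ _ _ oc (sE v) (sE w) xx) mulr0 !coord_field_center.
move=> /esym; rewrite -/w gE => /(metric_definite mgN) dw0.
have w0 : w = 0 by apply: ((qh_immersion QH).2 x); rewrite dw0 d0.
exact: esym (subr0_eq w0).
Qed.
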